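(* Let $(G_n,d_n)$ be an admissible sequence such that $t(F,G_n,d_n)$ converges for all trees $F$. Then there exists a probability space $\mathbf{G}=(X,\mathcal{B},\lambda,\deg)$ endowed with an acyclic reversible sub-Markov kernel such that $t(F,G_n,d_n)\to t(F,\mathbf{G})$ for all trees $F$.
   Context: Graphs are finite, simple and undirected. An admissible pair is a pair $(G,d)$ where $d\ge 1$ and $G$ is a graph with all degrees $\le d$; an admissible sequence is a sequence of admissible pairs. For a connected graph $F$, $t(F,G,d)=\hom(F,G)/\big(\mathrm{v}(G)d^{\,\mathrm{v}(F)-1}\big)$, where $\hom(F,G)$ is the number of homomorphisms and $\mathrm{v}$ the number of nodes. A sub-Markov kernel on a measurable space $(X,\mathcal{B})$ is a function $\deg:X\times\mathcal{B}\to[0,1]$, $(x,A)\mapsto\deg_A(x)$, such that $\deg_A$ is measurable for each $A\in\mathcal{B}$ and $\deg(x):A\mapsto\deg_A(x)$ is a measure for each $x\in X$. It is reversible with respect to a probability measure $\lambda$ on $(X,\mathcal{B})$ if $\int_A\deg_B\,d\lambda=\int_B\deg_A\,d\lambda$ for all $A,B\in\mathcal{B}$. Its powers are: $\deg^0(x)$ is the Dirac measure at $x$, $\deg^1=\deg$, and $\deg^k_A(x)=\int_X\deg^{k-1}_A\,d\deg(x)$ for $k\ge2$. The kernel on the probability space $(X,\mathcal{B},\lambda)$ is acyclic if $\deg^k(x)\perp\deg(x)$ (mutually singular measures) for $\lambda$-a.e. $x\in X$ and all integers $k\ge0$ with $k\ne1$. Tree densities: let $(F,o)$ be a rooted tree.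 Label its nodes by $0,1,\dots,\mathrm{v}(F)-1$ so that $o$ has label $0$ and, for each $i\ge1$, node $i$ has a (unique) neighbor $j(i)<i$. Put $t((F,o),(\mathbf{G},x_0))=\int_X\cdots\int_X 1\;d\deg(x_{j(\mathrm{v}(F)-1)})(x_{\mathrm{v}(F)-1})\cdots d\deg(x_{j(1)})(x_1)$ (iterated integral, innermost variable $x_{\mathrm{v}(F)-1}$); this is independent of the labeling. For a reversible kernel, $t(F,\mathbf{G})=\int_Xt((F,o),(\mathbf{G},x_0))\,d\lambda(x_0)$, which is independent of the root $o$. *)

(* Defs.v *)
From HB Require Import structures.
From mathcomp Require Import all_boot all_order all_algebra.
From mathcomp Require Import all_classical all_reals all_analysis.
Import Order.TTheory GRing.Theory Num.Theory.
Import numFieldNormedType.Exports.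

Set Implicit Arguments.
Unset Strict Implicit.
Unset Printing Implicit Defensive.

Local Open Scope classical_set_scope.
Local Open Scope ring_scope.

(** * Finite simple graphs *)

Record sgraph := SGraph {
  vertex :> finType;
  edge : rel vertex;
  edge_sym : symmetric edge;
  edge_irrefl : irreflexive edge }.

Arguments edge {s}.

Definition degree (G : sgraph) (v : G) : nat := #|[set w : G | edge v w]%SET|.

(* The density [hom_density] divides by the number of nodes, so the graph of an
   admissible pair has to have at least one node. *)
Definition admissible (G : sgraph) (d : nat) : Prop :=
  [/\ (0 < #|G|)%N, (0 < d)%N & forall v : G, (degree v <= d)%N].

Definition hom (F G : sgraph) : nat :=
  #|[set f : {ffun F -> G} |
      [forall u, forall v, edge u v ==> edge (f u) (f v)]]%SET|.

Definition hom_density (R : realType) (F G : sgraph) (d : nat) : R :=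
  (hom F G)%:R / (#|G|%:R * d%:R ^+ #|F|.-1).

(** * Trees *)

Definition connected_graph (F : sgraph) : Prop :=
  (0 < #|F|)%N /\ forall u v : F, connect edge u v.

(* [ucycle] accepts the empty sequence and both orientations of a single edge,
   which have size at most 2 and are not cycles of the graph. *)
Definition acyclic_graph (F : sgraph) : Prop :=
  forall c : seq F, ucycle edge c -> (size c <= 2)%N.

Definition is_tree (F : sgraph) : Prop := connected_graph F /\ acyclic_graph F.

(* [s] lists the nodes of [F] without repetition, the node labelled [i] being
   its [i]-th entry. *)
Definition is_labeling (F : sgraph) (o : F) (s : seq F) : bool :=
  [&& uniq s, size s == #|F|, nth o s 0 == o &
      all (fun i => count (edge (nth o s i)) (take i s) == 1%N)
          (iota 1 (size s).-1)].

(* [:: j 1; ...; j (size s).-1] *)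
Definition parents (F : sgraph) (o : F) (s : seq F) : seq nat :=
  [seq find (edge (nth o s i)) s | i <- iota 1 (size s).-1].

(** * Sub-Markov kernels *)

Section kernels.
Context {disp : measure_display} {X : measurableType disp} {R : realType}.
Implicit Type k : R.-spker X ~> X.

Local Open Scope ereal_scope.

Definition reversible (lambda : probability X R) k : Prop :=
  forall A B : set X, measurable A -> measurable B ->
    \int[lambda]_(x in A) k x B = \int[lambda]_(x in B) k x A.

Fixpoint kpow k (n : nat) : R.-spker X ~> X :=
  match n with
  | 0 => kdirac (@measurable_id _ X setT)
  | 1 => k
  | m.+1 => mkcomp_noparam k (kpow k m)
  end.

Definition mutually_singular (mu nu : {measure set X -> \bar R}) : Prop :=
  exists A : set X, [/\ measurable A, mu A = 0 & nu (~` A) = 0].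

Definition acyclic_kernel (lambda : probability X R) k : Prop :=
  {ae lambda, forall x : X, forall n : nat, n <> 1%N ->
    mutually_singular (kpow k n x) (k x)}.

(* [xs] holds the variables already fixed, in the order of their labels;
   [x0] is its first entry. *)
Fixpoint iter_int k (js : seq nat) (x0 : X) (xs : seq X) : \bar R :=
  match js with
  | [::] => 1
  | j :: js' => \int[k (nth x0 xs j)]_y iter_int k js' x0 (rcons xs y)
  end.

(* The default value is never used when [F] is a tree (see [labeling_exists]). *)
Definition rooted_density (F : sgraph) (o : F) k (x0 : X) : \bar R :=
  if [pick s : #|F|.-tuple F | is_labeling o s] is Some s
  then iter_int k (parents o s) x0 [:: x0] else 0.

Definition tree_density (F : sgraph) (lambda : probability X R) k : \bar R :=
  if [pick o : F] is Some o
  then \int[lambda]_x rooted_density o k x else 0.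

End kernels.

Section kpowE.
Context {disp : measure_display} {X : measurableType disp} {R : realType}.
Implicit Type k : R.-spker X ~> X.
Local Open Scope ereal_scope.

Lemma kpow0E k x A : kpow k 0 x A = \d_x A.
Proof. by []. Qed.

Lemma kpow1E k x A : kpow k 1 x A = k x A.
Proof. by []. Qed.

Lemma kpowSE k n x A :
  (0 < n)%N -> kpow k n.+1 x A = \int[k x]_y kpow k n y A.
Proof. by case: n. Qed.

End kpowE.

Section labeling_existence.
Variables (F : sgraph) (treeF : is_tree F) (o : F).

Let prelabeling (s : seq F) : Prop :=
  [/\ uniq s, nth o s 0 = o, (0 < size s)%N,
      forall i, (0 < i < size s)%N ->
        count (edge (nth o s i)) (take i s) = 1%N &
      {in s &, forall u w, exists p : seq F,
        [/\ path edge u p, last u p = w & {subset p <= s}]}].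

Let extend (s : seq F) : prelabeling s -> (size s < #|F|)%N ->
  exists v, prelabeling (rcons s v).
Proof.
move=> [us s0 ss cs ps] sF.
have os : o \in s by rewrite -s0 mem_nth.
have [v vs /hasP[u us' uv]] : exists2 v, v \notin s & has (edge v) s.
  apply: contrapT => nv; suff all_s : forall x : F, x \in s.
    move: sF; rewrite ltnNge -(card_uniqP us).
    by rewrite (_ : #|F| = #|s|) ?leqnn//; apply: eq_card => x; rewrite all_s.
  move=> x; have /connectP[p pp ->] := treeF.1.2 o x.
  elim: p o os pp => [//|y p IH] z zs /= /andP[zy pp].
  apply: IH => //; apply: contrapT => /negP ys; apply: nv; exists y => //.
  by apply/hasP; exists z => //; rewrite edge_sym.
have uniq_nb w : w \in s -> edge v w -> w = u.
  move=> ws vw; apply/eqP/negPn/negP => wu.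
  have [p [pp lp sp]] := ps _ _ us' ws.
  case/shortenP: pp lp => q pq uq sq lq.
  have qs : {subset u :: q <= s}.
    by move=> x; rewrite inE => /predU1P[->//|/sq/sp].
  have /treeF.2 : ucycle edge [:: v, u & q].
    rewrite /ucycle /= rcons_path pq lq uv edge_sym vw /=.
    by rewrite cons_uniq in uq; rewrite uq andbT; apply: contra vs => /qs.
  by case: q lq {pq uq sq qs} => //= lq; rewrite lq eqxx in wu.
exists v; split.
- by rewrite rcons_uniq vs.
- by rewrite nth_rcons ss.
- by rewrite size_rcons.
- move=> i; rewrite size_rcons ltnS => /andP[i0 ile].
  rewrite nth_rcons -cats1 takel_cat//.
  move: ile; rewrite leq_eqVlt => /predU1P[->|il]; last by rewrite il cs ?i0.
  rewrite ltnn eqxx take_size.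
  rewrite (@eq_in_count _ _ (pred1 u)); first by rewrite count_uniq_mem// us'.
  move=> w ws /=; apply/idP/eqP => [/uniq_nb->//|->//].
- have sub : {subset s <= rcons s v}.
    by move=> x; rewrite mem_rcons inE orbC => ->.
  have vr : v \in rcons s v by rewrite mem_rcons mem_head.
  move=> a b; rewrite !mem_rcons !inE.
  case/predU1P => [->|a_s] /predU1P[->|bs].
  + by exists [::].
  + have [p [pp lp sp]] := ps _ _ us' bs; exists (u :: p).
    split=> //=; first by rewrite uv.
    by move=> x; rewrite inE => /predU1P[->|/sp/sub//]; exact: sub.
  + have [p [pp lp sp]] := ps _ _ a_s us'; exists (rcons p v).
    split; first by rewrite rcons_path pp lp edge_sym.
      by rewrite last_rcons.
    by move=> x; rewrite mem_rcons inE => /predU1P[->//|/sp/sub].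
  + have [p [pp lp sp]] := ps _ _ a_s bs; exists p.
    by split=> // x /sp/sub.
Qed.

Lemma labeling_exists : exists s : #|F|.-tuple F, is_labeling o s.
Proof.
have [s [us s0 _ cs _] ss] : exists2 s, prelabeling s & size s = #|F|.
  have step n : (n < #|F|)%N -> exists2 s, prelabeling s & size s = n.+1.
    elim: n => [_|n IH nF].
      exists [:: o] => //; split=> //; first by case=> // i; rewrite andbF.
      by move=> a b; rewrite !inE => /eqP-> /eqP->; exists [::].
    have [s ps ss] := IH (ltnW nF).
    have [|v pv] := extend ps; first by rewrite ss.
    by exists (rcons s v) => //; rewrite size_rcons ss.
  have F0 : (0 < #|F|)%N := treeF.1.1.
  by have := step #|F|.-1; rewrite prednK//; apply.
have sP : size s == #|F| by rewrite ss.
exists (Tuple sP); apply/and4P; split => //=; first by rewrite s0.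
apply/allP => i; rewrite mem_iota add1n => /andP[i0 il].
apply/eqP/cs; rewrite i0 /=; apply: leq_trans il _.
by rewrite prednK// ss; exact: treeF.1.1.
Qed.

End labeling_existence.

(* Main.v *)
Require Import Defs.
From HB Require Import structures.
From mathcomp Require Import all_boot all_order all_algebra.
From mathcomp Require Import all_classical all_reals all_analysis.
From mathcomp Require Import measurable_realfun.
Import Order.TTheory GRing.Theory Num.Theory.
Import numFieldNormedType.Exports.
Local Open Scope classical_set_scope.
Local Open Scope ring_scope.

(** The limit object is a Loeb space. Fix a free ultrafilter [omega] on the
    natural numbers. Points of the limit are sequences [x] whose [n]-th term is
    a node of the [n]-th graph; the internal sets, those of the form
    [x n \in A n] for [omega]-almost all [n], form an algebra, and the
    [omega]-limit of finite masses is countably additive on it for a trivial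
    reason: by [saturation], an internal set covered by countably many internal
    sets is covered by finitely many of them. The uniform measures on the nodes
    thus give a probability measure, and for each [x] the measures that give
    mass [1 / d n] to each neighbor of [x n] give a measure [lim_deg x] of mass
    at most 1. The integral of an [omega]-limit of functions is the
    [omega]-limit of the finite weighted sums ([loeb_integral]). Three facts
    follow. The kernel is measurable and, since the edge relation is symmetric,
    reversible; both are checked on internal sets and extend to the generated
    sigma-algebra. An iterated integral over the limit is the [omega]-limit of
    the corresponding iterated sums ([iter_int_lim]). These sums run over the
    images of the nodes of a tree, taken in the order of a labeling, and they
    count homomorphisms ([hom_densityE]); as the densities converge, their
    [omega]-limit is their limit.

    Applied to the given graphs this kernel need not be acyclic: complete graphs
    with [d n] equal to the number of nodes give a kernel equal to its square.
    Instead, the graph [G n] is replaced by its product with a hypercube of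
    dimension [n + 1], and [d n] by [d n * n.+1]. A step in the product is a
    step in [G n] together with the flip of one coordinate. The hypercube is
    regular of degree [n + 1], so no tree density changes
    ([hom_density_cube]). As the dimension tends to infinity, almost no walk
    with [k] steps flips a coordinate twice; hence in the limit the [k]-th power
    of the kernel, started at [x], lives on the Hamming sphere of radius [k]
    about [x] ([kpow_sphere]). Spheres of different radii are disjoint, which is
    acyclicity. *)

Set Implicit Arguments.
Unset Strict Implicit.
Unset Printing Implicit Defensive.

(** * Limits along a free ultrafilter *)

Lemma free_ultrafilter_exists :
  exists U : set_system nat, UltraFilter U /\ \oo `<=` U.
Proof. exact: ultraFilterLemma. Qed.

Definition omega : set_system nat := sval (cid free_ultrafilter_exists).

Lemma omega_ultra : UltraFilter omega.
Proof. exact: (svalP (cid free_ultrafilter_exists)).1. Qed.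

Lemma omega_free : \oo `<=` omega.
Proof. exact: (svalP (cid free_ultrafilter_exists)).2. Qed.

#[global] Instance omega_proper : ProperFilter omega.
Proof. exact: (@ultra_proper _ _ omega_ultra). Qed.

Lemma near_omegaN (P : nat -> Prop) :
  ~ (\forall n \near omega, P n) -> \forall n \near omega, ~ P n.
Proof. by move=> nP; have [] := in_ultra_setVsetC [set n | P n] omega_ultra. Qed.

Section ultralimits.
Context {R : realType}.
Implicit Types u v : nat -> R.

Definition ulim u : R := lim (u n @[n --> omega]).

Lemma ulim_eq u l : u n @[n --> omega] --> l -> ulim u = l.
Proof. by move=> ul; apply: cvg_lim. Qed.

Lemma cvgn_ulim u (l : R) : u n @[n --> \oo] --> l -> u n @[n --> omega] --> l.
Proof. by apply: cvg_trans => A; exact: omega_free. Qed.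

(** In the compact segment [u] has a cluster point [l] along [omega]. It is the
    limit, because a neighborhood of [l] with a small preimage would have an
    [omega]-large preimage of its complement, which a cluster point excludes. *)
Lemma ulim_cvg a b u : (forall n, a <= u n <= b) ->
  u n @[n --> omega] --> ulim u.
Proof.
move=> uab.
have [] := @segment_compact R a b (u n @[n --> omega]) _.
  by apply: nearW => n; rewrite /= in_itv; exact: uab.
move=> l [_ cl]; suff ul : u n @[n --> omega] --> l by rewrite (ulim_eq ul).
move=> A Al; apply: contrapT => /near_omegaN nA.
by have [r []] := cl (~` A) A nA Al.
Qed.

Lemma ulim_near u v : (\forall n \near omega, u n = v n) -> ulim u = ulim v.
Proof.
move=> uv; suff uvE : fmap u omega = fmap v omega by rewrite /ulim uvE.
apply/seteqP; split => A uA; apply: filterS2 uv uA => n /=.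
- by move=> ->.
- by move=> <-.
Qed.

Lemma ulim_cst (a : R) : ulim (fun=> a) = a.
Proof. by apply: ulim_eq; exact: cvg_cst. Qed.

End ultralimits.

(** * Internal sets and countable saturation *)

(** The ultraproduct, kept as a type of plain sequences: internal sets cannot
    separate two sequences that agree [omega]-almost everywhere, so a quotient
    would not change the measure theory. [v0] is the base point. *)
Definition uprod (V : nat -> finType) (v0 : forall n, V n) : Type :=
  forall n, V n.

Section internal_sets.
Variables (V : nat -> finType) (v0 : forall n, V n).
Local Notation U := (uprod v0).
Implicit Types A B : forall n, {set V n}.

HB.instance Definition _ := gen_eqMixin U.
HB.instance Definition _ := gen_choiceMixin U.
HB.instance Definition _ := isPointed.Build U v0.

Definition internal A : set U := [set x | \forall n \near omega, x n \in A n].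

Lemma internal_ext A B :
  (\forall n \near omega, A n = B n) -> internal A = internal B.
Proof.
move=> AB; apply/seteqP; split => x; apply: filterS2 AB => n.
- by move=> ->.
- by move=> <-.
Qed.

Lemma internalT : internal (fun n => [set: V n]%SET) = setT.
Proof. by apply/seteqP; split => // x _; apply: nearW => n; rewrite inE. Qed.

Lemma internal0 : internal (fun n => finset.set0) = set0.
Proof.
apply/seteqP; split => // x; rewrite /internal /= => /filter_ex[n].
by rewrite inE.
Qed.

Lemma internalI A B :
  internal A `&` internal B = internal (fun n => A n :&: B n)%SET.
Proof.
apply/seteqP; split => x /=.
  by move=> [xA xB]; apply: filterS2 xA xB => n xA xB; rewrite inE xA.
by move=> xAB; split; apply: filterS xAB => n; rewrite inE => /andP[].
Qed.

(** Here the maximality of [omega] is essential: a set of indices that is not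
    large has a large complement. *)
Lemma internalC A : ~` internal A = internal (fun n => ~: A n)%SET.
Proof.
apply/seteqP; split => x /=.
  by move=> /near_omegaN; apply: filterS => n /negP; rewrite inE.
move=> xAC xA; suff /filter_ex[n []] : \forall n \near omega, False by [].
by apply: filterS2 xAC xA => n; rewrite inE => /negP.
Qed.

Lemma internalU A B :
  internal A `|` internal B = internal (fun n => A n :|: B n)%SET.
Proof.
rewrite -[LHS]setCK setCU !internalC internalI internalC.
by apply: internal_ext; apply: nearW => n; rewrite finset.setCI !finset.setCK.
Qed.

Lemma internal_nonempty A :
  (\forall n \near omega, A n != finset.set0) -> internal A !=set0.
Proof.
move=> A0.
have xP n : exists x, A n != finset.set0 -> x \in A n.
  by have [->|/finset.set0Pn[x xA]] := eqVneq (A n) finset.set0;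
    [exists (v0 n) | exists x].
exists (fun n => sval (cid (xP n))); apply: filterS A0 => n An.
exact: (svalP (cid (xP n))).
Qed.

Lemma internal_subset A B : internal A `<=` internal B ->
  \forall n \near omega, (A n \subset B n)%SET.
Proof.
move=> AB; apply: contrapT => /near_omegaN nAB.
have [|x] := @internal_nonempty (fun n => A n :\: B n)%SET.
  by apply: filterS nAB => n /negP; rewrite finset.setD_eq0.
rewrite (@internal_ext _ (fun n => A n :&: ~: B n)%SET); last first.
  by apply: nearW => n; rewrite finset.setDE.
by rewrite -internalI -internalC => -[/AB].
Qed.

Lemma internal_inj A B : internal A = internal B ->
  \forall n \near omega, A n = B n.
Proof.
move=> AB; have AsB : internal A `<=` internal B by rewrite AB.
have BsA : internal B `<=` internal A by rewrite AB.
apply: filterS2 (internal_subset AsB) (internal_subset BsA) => n AB' BA'.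
by apply/eqP; rewrite finset.eqEsubset AB'.
Qed.

(** A diagonal choice: [x n] is taken in the smallest nonempty set among
    [B 0 n], ..., [B n n]. For a given [k], the indices [n] that are at least
    [k] and satisfy [B k n != set0] are [omega]-large, and there [x n] belongs
    to [B k n]. *)
Lemma saturation (B : nat -> forall n, {set V n}) :
    (forall k n, B k.+1 n \subset B k n)%SET ->
    (forall k, internal (B k) !=set0) ->
  \bigcap_k internal (B k) !=set0.
Proof.
move=> decB neB.
have decBle k l n : (k <= l)%N -> (B l n \subset B k n)%SET.
  move=> /subnK <-; elim: (l - k)%N => // i IH.
  by rewrite addSn; exact: fintype.subset_trans (decB _ _) IH.
pose good n k := B k n != finset.set0.
have xP n : exists x, forall k, (k <= n)%N -> good n k -> x \in B k n.
  have [g0|ng0] := boolP (good n 0%N); last first.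
    exists (v0 n) => k _ /finset.set0Pn[x xB].
    case/finset.set0Pn: ng0; exists x.
    exact: (fintype.subsetP (decBle 0%N k n _)).
  have ex : exists k, (k <= n)%N && good n k by exists 0%N.
  have bnd k : (k <= n)%N && good n k -> (k <= n)%N by case/andP.
  have [m /andP[_ /finset.set0Pn[x xB]] mmax] := ex_maxnP ex bnd.
  exists x => k kn gk; apply: (fintype.subsetP (decBle k m n _)) => //.
  by apply: mmax; rewrite kn.
exists (fun n => sval (cid (xP n))) => k _.
have [y yB] := neB k.
have kn : \forall n \near omega, (k <= n)%N.
  by apply: omega_free; exact: nbhs_infty_ge.
apply: filterS2 kn yB => n kn yB; apply: (svalP (cid (xP n))) => //.
by apply/finset.set0Pn; exists (y n).
Qed.

Definition is_internal (S : set U) : Prop := exists A, S = internal A.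

Let is_internal0 : is_internal set0.
Proof. by eexists; exact/esym/internal0. Qed.

Let is_internalU : setU_closed is_internal.
Proof. by move=> _ _ [A ->] [B ->]; eexists; exact: internalU. Qed.

Let is_internalC : setC_closed is_internal.
Proof. by move=> _ [A ->]; eexists; exact: internalC. Qed.

Definition uprod_display : measure_display.
Proof. exact: default_measure_display. Qed.

HB.instance Definition _ := @isAlgebraOfSets.Build uprod_display U
  is_internal is_internal0 is_internalU is_internalC.

Lemma internal_bigsetU (F : nat -> set U) N : (forall i, is_internal (F i)) ->
  is_internal (\big[setU/set0]_(i < N) F i).
Proof.
move=> iF; elim: N => [|N IH]; first by rewrite big_ord0.
by rewrite big_ord_recr; exact: is_internalU.
Qed.

(** Otherwise the differences of [S] with the finite unions would be a
    decreasing sequence of nonempty internal sets, and [saturation] would give a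
    point of [S] outside every [F i]. *)
Lemma internal_compact (S : set U) (F : nat -> set U) : is_internal S ->
    (forall i, is_internal (F i)) -> S `<=` \bigcup_i F i ->
  exists N, S `<=` \big[setU/set0]_(i < N) F i.
Proof.
move=> [A ->] iF AF.
pose C i := sval (cid (iF i)); have CE i : F i = internal (C i).
  exact: (svalP (cid (iF i))).
pose B := fix B k n : {set V n} :=
  (if k is k'.+1 then B k' n :\: C k' n else A n)%SET.
have BE k : internal (B k) = internal A `\` \big[setU/set0]_(i < k) F i.
  elim: k => [|k IH]; first by rewrite big_ord0 setD0.
  rewrite big_ord_recr/= -setDDl -IH CE setDE internalC internalI.
  by apply: internal_ext; apply: nearW => n /=; rewrite finset.setDE.
apply: contrapT => nN.
have [|k|x Bx] := @saturation B.
- by move=> k n; rewrite /= finset.subsetDl.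
- rewrite BE; apply/set0P/negP => /eqP; rewrite setD_eq0 => AN.
  by apply: nN; exists k.
- have [i _ Fi] : (\bigcup_i F i) x.
    by apply: AF; have := Bx 0%N I; rewrite BE => -[].
  have := Bx i.+1 I; rewrite BE => -[_]; apply.
  by rewrite big_ord_recr; right.
Qed.

End internal_sets.

Arguments internal {V} v0 A _.

(** * Loeb measures *)

Record weight (R : realType) (V : nat -> finType) := Weight {
  wgt :> forall n, V n -> R ;
  wgt_ge0 : forall n (v : V n), 0 <= wgt v ;
  wgt_le1 : forall n, \sum_(v : V n) wgt v <= 1 }.

Arguments wgt {R V} w n v.
Arguments wgt_ge0 {R V} w n v.
Arguments wgt_le1 {R V} w n.

Section loeb_premeasure.
Variables (R : realType) (V : nat -> finType) (v0 : forall n, V n).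
Variable w : weight R V.
Local Notation U := (uprod v0).
Implicit Types A B : forall n, {set V n}.

Definition mass n (A : {set V n}) : R := \sum_(v in A) w n v.

Lemma mass_itv n (A : {set V n}) : 0 <= mass A <= 1.
Proof.
apply/andP; split; first by apply: sumr_ge0 => v _; exact: wgt_ge0.
apply: le_trans (wgt_le1 w n); rewrite [leRHS](bigID (mem A)) /= lerDl.
by apply: sumr_ge0 => v _; exact: wgt_ge0.
Qed.

Lemma mass_cvg A : mass (A n) @[n --> omega] --> ulim (fun n => mass (A n)).
Proof. by apply: ulim_cvg => n; exact: mass_itv. Qed.

(** Two sequences of finite sets that define the same internal set agree
    [omega]-almost everywhere ([internal_inj]), so the value on an internal set
    does not depend on the chosen representation; see [premeasE]. *)
Definition premeas (S : set U) : \bar R :=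
  (ulim (fun n =>
    mass (xget (fun=> finset.set0) [set A | S = internal v0 A] n)))%:E.

Lemma premeasE A : premeas (internal v0 A) = (ulim (fun n => mass (A n)))%:E.
Proof.
congr (_ %:E); apply: ulim_near.
case: xgetP => [B _ /=|/(_ A)/(_ erefl)//].
by move=> /internal_inj; apply: filterS => n ->.
Qed.

Lemma premeas0 : premeas set0 = 0%E.
Proof.
rewrite -(internal0 v0) premeasE; congr (_%:E).
rewrite -[RHS](ulim_cst 0); apply: ulim_near; apply: nearW => n.
by rewrite /mass big_set0.
Qed.

Lemma premeas_ge0 (S : set U) : (0 <= premeas S)%E.
Proof.
rewrite lee_fin; apply: limr_ge; first exact: mass_cvg.
by apply: nearW => n; exact: (proj1 (andP (mass_itv _))).
Qed.

Lemma premeasU (S T : set U) : is_internal S -> is_internal T ->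
  S `&` T = set0 -> premeas (S `|` T) = (premeas S + premeas T)%E.
Proof.
move=> [A ->] [B ->]; rewrite internalI -(internal0 v0) => /internal_inj AB.
rewrite internalU !premeasE -EFinD; congr (_%:E).
rewrite -(ulim_eq (cvgD (@mass_cvg A) (@mass_cvg B))).
apply: ulim_near; apply: filterS AB => n AB.
rewrite /mass /= -bigU; last by rewrite /= -finset.setI_eq0 AB.
by apply: eq_bigl => v; rewrite !inE.
Qed.

(** By [internal_compact], the union is already the union of finitely many of
    the disjoint sets, so the series is eventually constant. *)
Lemma premeas_sigma_additive : semi_sigma_additive premeas.
Proof.
move=> F mF tF mUF.
have [N UFN] := internal_compact mUF mF (@subset_refl _ _).
have UF n : (N <= n)%N -> \bigcup_i F i = \big[setU/set0]_(i < n) F i.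
  move=> Nn; apply/seteqP; split; last exact: bigsetU_bigcup.
  by apply: subset_trans UFN _; exact: subset_bigsetU.
have add n : \sum_(0 <= i < n) premeas (F i)
           = premeas (\big[setU/set0]_(i < n) F i).
  elim: n => [|n IH]; first by rewrite big_geq// big_ord0 premeas0.
  rewrite big_nat_recr//= IH big_ord_recr/= premeasU//.
  - exact: internal_bigsetU.
  - exact: mF.
  - by apply: (@trivIset_bigsetUI _ predT) => //; rewrite /predT /= trueE.
apply: cvg_near_cst; exists N => // n /= Nn.
by rewrite add -UF.
Qed.

HB.instance Definition _ := isMeasure.Build _ U R premeas
  premeas0 premeas_ge0 premeas_sigma_additive.

End loeb_premeasure.
Arguments premeas {R V} v0 w S.

Section loeb_space.
Variables (V : nat -> finType) (v0 : forall n, V n).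
Definition loeb_space := g_sigma_algebraType (@measurable _ (uprod v0)).
HB.instance Definition _ := Measurable.on loeb_space.
End loeb_space.

Section loeb_measure.
Variables (R : realType) (V : nat -> finType) (v0 : forall n, V n).
Variable w : weight R V.
Local Notation X := (loeb_space v0).

Definition loeb : set X -> \bar R := measure_extension (premeas v0 w).
HB.instance Definition _ := Measure.on loeb.

Lemma measurable_internal (A : forall n, {set V n}) :
  measurable (internal v0 A : set X).
Proof. by apply: sub_sigma_algebra; exists A. Qed.

Lemma loebE (A : forall n, {set V n}) :
  loeb (internal v0 A) = (ulim (fun n => mass w (A n)))%:E.
Proof.
rewrite -(premeasE v0) /loeb /measure_extension measurable_mu_extE//.
by exists A.
Qed.

End loeb_measure.

Arguments loeb {R V} v0 w _.

(** * Integration of limits of functions *)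

Section loeb_subprob.
Variables (R : realType) (V : nat -> finType) (v0 : forall n, V n).
Variable w : weight R V.

Lemma loeb_setT_le1 : (loeb v0 w setT <= 1)%E.
Proof.
rewrite -internalT loebE lee_fin; apply: limr_le.
  exact: (@mass_cvg _ _ w (fun n => [set: V n]%SET)).
by apply: nearW => n; have /andP[] := mass_itv w [set: V n]%SET.
Qed.

End loeb_subprob.

(** The sum is the integral part of [y]. *)
Lemma floor_count (R : realType) (N : nat) (y : R) : 0 <= y <= N%:R ->
  \sum_(i < N) (i.+1%:R <= y)%R%:R <= y <= \sum_(i < N) (i.+1%:R <= y)%R%:R + 1.
Proof.
move=> /andP[y0]; elim: N => [|N IH] yN.
  by rewrite big_ord0 y0 (le_trans yN)//= add0r.
rewrite big_ord_recr /=; have [yN'|Ny] := leP y N%:R.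
  have /andP[lo hi] := IH yN'.
  rewrite [N.+1%:R <= y](_ : _ = false) ?addr0 ?lo//.
  by apply/negbTE; rewrite -ltNge; apply: le_lt_trans yN' _; rewrite ltr_nat.
rewrite (eq_bigr (fun=> 1)) => [|i _]; last first.
  by rewrite (le_trans _ (ltW Ny))// ler_nat.
rewrite sumr_const card_ord.
have [yN1|//] := leP N.+1%:R y; last first.
  by move=> _; rewrite addr0 (ltW Ny) -natr1 in yN *.
by rewrite natr1 yN1 (le_trans yN)// lerDl.
Qed.

Section loeb_integral.
Variables (R : realType) (V : nat -> finType) (v0 : forall n, V n).
Local Notation X := (loeb_space v0).
Variable f : forall n, V n -> R.
Hypothesis f01 : forall n v, 0 <= @f n v <= 1.

(** The function induced on the limit by the sequence [f], sometimes called the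
    standard part of the internal function [f]. *)
Definition ufun (x : X) : R := ulim (fun n => f (x n)).

Definition superlevel N i n : {set V n} :=
  [set v | i.+1%:R <= N%:R * @f n v]%SET.

(** The layer-cake approximation of [ufun] with steps of height [1 / N]; its
    layers are internal, so its integral is known. *)
Definition ustep N (x : X) : R :=
  \sum_(i < N) N%:R^-1 * \1_(internal v0 (superlevel N i)) x.

Lemma superlevel_step N n (v : V n) : (0 < N)%N ->
  \sum_(i < N) N%:R^-1 * (v \in superlevel N i n)%:R <= f v <=
  \sum_(i < N) N%:R^-1 * (v \in superlevel N i n)%:R + N%:R^-1.
Proof.
move=> N0; have N0' : 0 < N%:R :> R by rewrite ltr0n.
have /andP[f0 f1] := f01 v.
have : 0 <= N%:R * f v <= N%:R by rewrite mulr_ge0// ler_piMr.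
move=> /floor_count /andP[lo hi]; rewrite -mulr_sumr.
under eq_bigr do rewrite inE.
rewrite -[X in _ <= _ <= _ + X]mulr1 -mulrDr.
by rewrite ler_pdivrMl// ler_pdivlMl// lo.
Qed.

Lemma ufun_cvg (x : X) : f (x n) @[n --> omega] --> ufun x.
Proof. by apply: ulim_cvg. Qed.

(** Finitely many layers are involved, so for [omega]-almost all [n] they
    contain [x n] exactly when their limits contain [x]; at such an [n] the
    finite estimate [superlevel_step] applies. *)
Lemma ufun_step N (x : X) : (0 < N)%N ->
  ustep N x <= ufun x <= ustep N x + N%:R^-1.
Proof.
move=> N0.
have nearS : \forall n \near omega,
    \sum_(i < N) N%:R^-1 * (x n \in superlevel N i n)%:R = ustep N x.
  have : \forall n \near omega, forall i : 'I_N,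
      (x n \in superlevel N i n) = (x \in internal v0 (superlevel N i)).
    apply: filter_forall => i.
    have [xi|/negP xi] := boolP (x \in internal v0 (superlevel N i)).
      by move/set_mem: xi; apply: filterS => n ->.
    have /near_omegaN : ~ internal v0 (superlevel N i) x.
      by move=> xi'; apply: xi; exact: mem_set.
    by apply: filterS => n /negP/negbTE ->.
  apply: filterS => n xn; apply: eq_bigr => i _.
  by rewrite indicE xn.
apply/andP; split.
- apply: limr_ge; first exact: ufun_cvg.
  apply: filterS nearS => n <-.
  by have /andP[] := superlevel_step (x n) N0.
- apply: limr_le; first exact: ufun_cvg.
  apply: filterS nearS => n <-.
  by have /andP[] := superlevel_step (x n) N0.
Qed.

Lemma ufun_ge0 x : 0 <= ufun x.
Proof.
apply: limr_ge; first exact: ufun_cvg.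
by apply: nearW => n; have /andP[] := f01 (x n).
Qed.

Lemma measurable_ustep N : measurable_fun setT (ustep N).
Proof.
apply: measurable_sum => i; apply: measurable_funM => //.
by apply: measurable_indic; exact: measurable_internal.
Qed.

Lemma measurable_ufun : measurable_fun setT ufun.
Proof.
apply: (@measurable_fun_cvg _ _ _ _ (fun N => ustep N.+1)) => [N|x _].
  exact: measurable_ustep.
apply: (@squeeze_cvgr _ _ _ _ (fun N => ufun x - N.+1%:R^-1) (fun=> ufun x)).
- apply: nearW => N; have /andP[lo hi] := @ufun_step N.+1 x isT.
  by rewrite lo lerBlDr hi.
- rewrite -[X in _ --> X]subr0; apply: cvgB; first exact: cvg_cst.
  exact: cvg_harmonic.
- exact: cvg_cst.
Qed.

Variable w : weight R V.

Let J N : R := \sum_(i < N) N%:R^-1 *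
  ulim (fun n => mass w (superlevel N i n)).

Let ustep_ge0 N x : 0 <= ustep N x.
Proof.
by apply: sumr_ge0 => i _; rewrite mulr_ge0// indicE.
Qed.

Let integral_ustep N : (\int[loeb v0 w]_x (ustep N x)%:E = (J N)%:E)%E.
Proof.
under eq_integral do rewrite /ustep -sumEFin.
rewrite ge0_integral_sum//=.
- rewrite -sumEFin; apply: eq_bigr => i _.
  under eq_integral do rewrite EFinM.
  rewrite ge0_integralZl_EFin//=.
  + by rewrite integral_indic//= ?setIT ?loebE//; exact: measurable_internal.
  + by apply/measurable_EFinP/measurable_indic; exact: measurable_internal.
- move=> i; apply/measurable_EFinP; apply: measurable_funM => //.
  by apply: measurable_indic; exact: measurable_internal.
Qed.

Let wsum n : R := \sum_v w n v * f v.

Let wsum_itv n : 0 <= wsum n <= 1.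
Proof.
apply/andP; split.
  by apply: sumr_ge0 => v _; rewrite mulr_ge0 ?wgt_ge0//; have /andP[] := f01 v.
apply: le_trans (wgt_le1 w n); apply: ler_sum => v _.
by rewrite ler_piMr ?wgt_ge0//; have /andP[] := f01 v.
Qed.

Let wsum_cvg : wsum n @[n --> omega] --> ulim wsum.
Proof. exact: ulim_cvg wsum_itv. Qed.

Let wsum_step N : (0 < N)%N -> J N <= ulim wsum <= J N + N%:R^-1.
Proof.
move=> N0.
pose j n := \sum_(i < N) N%:R^-1 * mass w (superlevel N i n).
have jJ : j n @[n --> omega] --> J N.
  apply: cvg_big => [|i _]; first exact: add_continuous.
  by apply: cvgMl_tmp; exact: mass_cvg.
have jE n : j n = \sum_v w n v *
    \sum_(i < N) N%:R^-1 * (v \in superlevel N i n)%:R.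
  under [RHS]eq_bigr do rewrite mulr_sumr.
  rewrite exchange_big /=; apply: eq_bigr => i _.
  rewrite /mass mulr_sumr big_mkcond /=; apply: eq_bigr => v _.
  by case: ifP => _; rewrite ?mulr1 ?mulr0// mulrC.
apply/andP; split.
- apply: (ler_cvg_to jJ wsum_cvg); apply: nearW => n; rewrite jE.
  apply: ler_sum => v _; apply: ler_wpM2l; first exact: wgt_ge0.
  by have /andP[] := superlevel_step v N0.
- have jJ1 : j n + N%:R^-1 @[n --> omega] --> J N + N%:R^-1.
    by apply: cvgD => //; exact: cvg_cst.
  apply: (ler_cvg_to wsum_cvg jJ1); apply: nearW => n; rewrite jE.
  apply: (@le_trans _ _ (\sum_v w n v *
      (\sum_(i < N) N%:R^-1 * (v \in superlevel N i n)%:R + N%:R^-1))).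
    apply: ler_sum => v _; apply: ler_wpM2l; first exact: wgt_ge0.
    by have /andP[] := superlevel_step v N0.
  under eq_bigr do rewrite mulrDr.
  by rewrite big_split /= lerD2l -mulr_suml ler_piMl// wgt_le1.
Qed.

(** For every [N] both sides lie between the integral [J N] of the step function
    [ustep N] and [J N + 1 / N]. *)
Lemma loeb_integral : (\int[loeb v0 w]_x (ufun x)%:E =
  (ulim (fun n => \sum_v w n v * f v))%:E)%E.
Proof.
have mu := measurable_ufun.
have lo N : (0 < N)%N -> ((J N)%:E <= \int[loeb v0 w]_x (ufun x)%:E)%E.
  move=> N0; rewrite -integral_ustep; apply: ge0_le_integral => //=.
  - by move=> x _; rewrite lee_fin.
  - by apply/measurable_EFinP; exact: measurable_ustep.
  - exact/measurable_EFinP.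
  - by move=> x _; rewrite lee_fin; have /andP[] := ufun_step x N0.
have hi N : (0 < N)%N ->
    (\int[loeb v0 w]_x (ufun x)%:E <= (J N)%:E + (N%:R^-1)%:E)%E.
  move=> N0.
  apply: (@le_trans _ _ (\int[loeb v0 w]_x ((ustep N x)%:E + (N%:R^-1)%:E))%E).
    apply: ge0_le_integral => //=.
    - by move=> x _; rewrite lee_fin ufun_ge0.
    - exact/measurable_EFinP.
    - apply/measurable_EFinP; apply: measurable_funD => //.
      exact: measurable_ustep.
    - by move=> x _; rewrite -EFinD lee_fin; have /andP[] := ufun_step x N0.
  rewrite ge0_integralD//=.
  - rewrite integral_ustep leeD2l// integral_cst//= -[leRHS]mule1.
    by apply: lee_wpmul2l; rewrite ?lee_fin// loeb_setT_le1.
  - by move=> x _; rewrite lee_fin.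
  - by apply/measurable_EFinP; exact: measurable_ustep.
have small (e : R) : 0 < e -> exists2 N, (0 < N)%N & N%:R^-1 <= e.
  move=> e0; exists (Num.truncn e^-1).+1 => //.
  by rewrite -[leRHS]invrK lef_pV2 ?posrE ?invr_gt0// ltW// truncnS_gt.
apply/eqP; rewrite eq_le; apply/andP; split; apply/lee_addgt0Pr => e e0;
  have [N N0 Ne] := small e e0; have /andP[loN hiN] := wsum_step N0.
- apply: le_trans (hi N N0) _; rewrite -!EFinD lee_fin.
  exact: lerD.
- apply: le_trans (leeD2r _ (lo N N0)); rewrite -EFinD lee_fin.
  by rewrite (le_trans hiN)// lerD2l.
Qed.

End loeb_integral.

(** * The limit kernel and its iterated integrals *)

Section iter_sum.
Variables (R : realType) (G : sgraph) (d : nat).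

Definition nbr_mass (v u : G) : R := (edge v u)%:R / d%:R.

(** The finite counterpart of [iter_int], for the kernel that gives mass [1 / d]
    to each neighbor. *)
Fixpoint iter_sum (js : seq nat) (x0 : G) (xs : seq G) : R :=
  if js is j :: js' then
    \sum_y nbr_mass (nth x0 xs j) y * iter_sum js' x0 (rcons xs y)
  else 1.

Lemma nbr_mass_ge0 v u : 0 <= nbr_mass v u.
Proof. exact: divr_ge0. Qed.

Lemma nbr_massC v u : nbr_mass v u = nbr_mass u v.
Proof. by rewrite /nbr_mass edge_sym. Qed.

Lemma nbr_mass_le1 v : admissible G d -> \sum_u nbr_mass v u <= 1.
Proof.
move=> [_ d0 deg_d]; rewrite -mulr_suml ler_pdivrMr ?ltr0n// mul1r.
rewrite -natr_sum ler_nat (leq_trans _ (deg_d v))// /degree -sum1dep_card.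
by rewrite [leqRHS]big_mkcond.
Qed.

Lemma iter_sum_itv js x0 xs : admissible G d -> 0 <= iter_sum js x0 xs <= 1.
Proof.
move=> adm; elim: js xs => [|j js IH] xs /=; first by rewrite ler01 lexx.
apply/andP; split.
  apply: sumr_ge0 => y _; rewrite mulr_ge0 ?nbr_mass_ge0//.
  by have /andP[] := IH (rcons xs y).
apply: le_trans (nbr_mass_le1 (nth x0 xs j) adm).
apply: ler_sum => y _; rewrite ler_piMr ?nbr_mass_ge0//.
by have /andP[] := IH (rcons xs y).
Qed.

End iter_sum.
Arguments nbr_mass R {G} d v u.
Arguments iter_sum R {G} d js x0 xs.

Section limit_kernel.
Variables (R : realType) (G : nat -> sgraph) (d : nat -> nat).
Hypothesis admG : forall n, admissible (G n) (d n).
Variable v0 : forall n, G n.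
Local Notation X := (loeb_space (V := fun n => vertex (G n)) v0).

Let unif_ge0 n (v : G n) : 0 <= #|G n|%:R^-1 :> R.
Proof. by []. Qed.

Lemma sum_unif n : \sum_(v : G n) #|G n|%:R^-1 = 1 :> R.
Proof.
rewrite sumr_const -[LHS]mulr_natl mulfV// pnatr_eq0 -lt0n.
by have [] := admG n.
Qed.

Let unif_le1 n : \sum_(v : G n) #|G n|%:R^-1 <= 1 :> R.
Proof. by rewrite sum_unif. Qed.

Definition unif_weight : weight R (fun n => vertex (G n)) :=
  Weight unif_ge0 unif_le1.

Definition lim_prob : set X -> \bar R := loeb v0 unif_weight.

HB.instance Definition _ := Measure.on lim_prob.

Let lim_probT : lim_prob setT = 1%E.
Proof.
rewrite /lim_prob -internalT loebE; congr (_%:E).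
rewrite -[RHS](ulim_cst 1); apply: ulim_near; apply: nearW => n.
by rewrite /mass -[RHS](sum_unif n); apply: eq_bigl => v; rewrite inE.
Qed.

HB.instance Definition _ :=
  Measure_isProbability.Build _ _ _ lim_prob lim_probT.

Definition nbr_weight (x : X) : weight R (fun n => vertex (G n)) :=
  Weight (fun n => @nbr_mass_ge0 R (G n) (d n) (x n))
         (fun n => nbr_mass_le1 R (x n) (admG n)).

Definition lim_deg (x : X) : {measure set X -> \bar R} :=
  loeb v0 (nbr_weight x).

Definition nbr_frac (A : forall n, {set G n}) n (v : G n) : R :=
  \sum_(u in A n) nbr_mass R (d n) v u.

Lemma nbr_frac_itv (A : forall n, {set G n}) n (v : G n) :
  0 <= nbr_frac A v <= 1.
Proof.
apply/andP; split; first by apply: sumr_ge0 => u _; exact: nbr_mass_ge0.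
apply: le_trans (nbr_mass_le1 R v (admG n)).
rewrite [leRHS](bigID (mem (A n))) /= lerDl.
by apply: sumr_ge0 => u _; exact: nbr_mass_ge0.
Qed.

Lemma lim_deg_internal (A : forall n, {set G n}) x :
  lim_deg x (internal v0 A) = (ufun (nbr_frac A) x)%:E.
Proof. by rewrite /lim_deg /= loebE. Qed.

(** On an internal set the function is induced by the sequence of the relative
    degrees into the sets [A n]; the internal sets are a pi-system. *)
Lemma measurable_lim_deg U : measurable U ->
  measurable_fun [set: X] (lim_deg ^~ U).
Proof.
have internal_case A : measurable_fun [set: X] (lim_deg ^~ (internal v0 A)).
  apply: (eq_measurable_fun (EFin \o ufun (nbr_frac A))).
    by move=> x _; rewrite lim_deg_internal.
  by apply/measurable_EFinP; exact: measurable_ufun (@nbr_frac_itv A).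
move: U; apply: (@dynkin_induction _ X (@measurable _ (uprod v0))) => //.
- by move=> A B; exact: measurableI.
- by have := internal_case (fun n => [set: G n]%SET); rewrite internalT.
- by move=> _ [A ->].
- move=> S mS IH.
  apply: (eq_measurable_fun (fun x => lim_deg x setT - lim_deg x S)%E).
    move=> x _; rewrite -setTD measureD ?setTI//.
    exact: le_lt_trans (loeb_setT_le1 _ _) (ltry _).
  by apply: emeasurable_funB => //; have := internal_case
    (fun n => [set: G n]%SET); rewrite internalT.
- move=> F mF tF IH.
  apply: (eq_measurable_fun (fun x => \sum_(0 <= k <oo) lim_deg x (F k))%E).
    by move=> x _; rewrite measure_semi_bigcup//; exact: bigcup_measurable.
  exact: ge0_emeasurable_sum.
Qed.

HB.instance Definition _ := isKernel.Build _ _ X X R lim_deg measurable_lim_deg.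

Let lim_deg_le1 : (ereal_sup [set lim_deg x [set: X] | x in [set: X]] <= 1)%E.
Proof. by apply: ge_ereal_sup => _ [x _ <-]; exact: loeb_setT_le1. Qed.

HB.instance Definition _ :=
  Kernel_isSubProbability.Build _ _ X X R lim_deg lim_deg_le1.

(** Once the previous points are fixed, the inner integral is a function of the
    next point induced by a sequence of finite functions, so [loeb_integral]
    moves the limit out of one integral at a time. *)
Lemma iter_int_lim js (x0 : X) (xs : seq X) :
  iter_int lim_deg js x0 xs =
  (ulim (fun n => iter_sum R (d n) js (x0 n) [seq x n | x <- xs]))%:E.
Proof.
elim: js xs => [|j js IH] xs /=; first by rewrite ulim_cst.
pose f n (u : G n) : R :=
  iter_sum R (d n) js (x0 n) (rcons [seq x n | x : X <- xs] u).
have f01 n (u : G n) : 0 <= f n u <= 1 by exact: iter_sum_itv.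
rewrite (eq_integral (fun y => (ufun f y)%:E)); last first.
  move=> y _; rewrite IH; congr (_%:E); apply: ulim_near; apply: nearW => n.
  by rewrite map_rcons.
rewrite loeb_integral//; congr (_%:E); apply: ulim_near; apply: nearW => n.
apply: eq_bigr => u _; congr (nbr_mass _ _ _ _ * _).
have [jxs|jxs] := ltnP j (size xs); first by rewrite (nth_map x0).
by rewrite !nth_default// size_map.
Qed.

Lemma integral_iter_int js : (\int[lim_prob]_x iter_int lim_deg js x [:: x] =
  (ulim (fun n => #|G n|%:R^-1 *
     \sum_(v : G n) iter_sum R (d n) js v [:: v]))%:E)%E.
Proof.
pose f n (v : G n) : R := iter_sum R (d n) js v [:: v].
have f01 n (u : G n) : 0 <= f n u <= 1 by exact: iter_sum_itv.
rewrite (eq_integral (fun y => (ufun f y)%:E)); last first.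
  by move=> y _; rewrite iter_int_lim.
rewrite loeb_integral//; congr (_%:E); apply: ulim_near; apply: nearW => n.
by rewrite mulr_sumr.
Qed.

End limit_kernel.

Arguments lim_prob R {G d} admG v0 _.
Arguments lim_deg R {G d} admG {v0} x.

(** * Reversibility *)

Section reversibility.
Context {disp : measure_display} {X : measurableType disp} {R : realType}.
Variables (lambda : probability X R) (k : R.-spker X ~> X).
Variable E : set (set X).
Hypotheses (measurableE : @measurable _ X = <<s E >>) (EI : setI_closed E).
Hypothesis ET : E setT.
Local Open Scope ereal_scope.

Let mk A : measurable A -> measurable_fun setT (k ^~ A).
Proof. exact: measurable_kernel. Qed.

(** For fixed [A], both sides are finite measures in [B], so the sets [B] where
    they agree form a Dynkin system. *)
Let swap_extends A : measurable A ->
  (forall B, E B -> \int[lambda]_(x in A) k x B = \int[lambda]_(x in B) k x A) ->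
  forall B, measurable B ->
    \int[lambda]_(x in A) k x B = \int[lambda]_(x in B) k x A.
Proof.
move=> mA swapE B; rewrite measurableE; move: B.
apply: (@dynkin_induction _ X E) => //; first exact: swapE.
- move=> S mS swapS.
  have mSC : measurable (~` S) by exact: measurableC.
  have kT := swapE _ ET.
  have fin : \int[lambda]_(x in A) k x S \is a fin_num.
    rewrite ge0_fin_numE; last exact: integral_ge0.
    apply: (@le_lt_trans _ _ (\int[lambda]_(x in A) cst 1 x)).
      apply: ge0_le_integral => //.
      - exact/measurable_funTS/mk.
      - move=> x _; apply: le_trans (sprob_kernel_le1 k x).
        by apply: le_measure; rewrite ?inE.
    rewrite integral_cst// mul1e.
    exact: le_lt_trans (probability_le1 _ mA) (ltry _).
  rewrite -[LHS](addeK _ fin) -[RHS](addeK _ fin); congr (_ - _).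
  rewrite {2}swapS -ge0_integralD//; last 2 first.
    exact/measurable_funTS/mk.
    exact/measurable_funTS/mk.
  rewrite -ge0_integral_setU//; last 2 first.
    exact/measurable_funTS/mk.
    by apply/disj_setPS; rewrite setICl.
  rewrite setvU -kT; apply: eq_integral => x _.
  by rewrite -measureU ?setvU// setICl.
- move=> F mF tF swapF.
  rewrite ge0_integral_bigcup//; last first.
    by apply/measurable_funTS/mk.
  rewrite (eq_eseriesr (fun i _ => esym (swapF i))).
  rewrite -integral_nneseries//; last first.
    by move=> i; apply/measurable_funTS/mk.
  apply: eq_integral => x _; rewrite measure_semi_bigcup//.
  exact: bigcup_measurable.
Qed.

(** The extension from generators to measurable sets is made first in one
    argument, then in the other. *)
Lemma reversible_on_generators :
  (forall A B, E A -> E B ->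
    \int[lambda]_(x in A) k x B = \int[lambda]_(x in B) k x A) ->
  reversible lambda k.
Proof.
move=> swapE A B mA mB; have EM C : E C -> measurable C.
  by move=> EC; rewrite measurableE; exact: sub_sigma_algebra.
apply: swap_extends => // C EC; apply/esym; apply: swap_extends => //.
  exact: EM.
by move=> D ED; exact: swapE.
Qed.

End reversibility.

Section limit_reversible.
Variables (R : realType) (G : nat -> sgraph) (d : nat -> nat).
Hypothesis admG : forall n, admissible (G n) (d n).
Variable v0 : forall n, G n.
Local Notation X := (loeb_space (V := fun n => vertex (G n)) v0).

Lemma integral_lim_deg_internal (A B : forall n, {set G n}) :
  (\int[lim_prob R admG v0]_(x in internal v0 A)
     lim_deg R admG x (internal v0 B) =
  (ulim (fun n => \sum_(v in A n) \sum_(u in B n)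
     #|G n|%:R^-1 * nbr_mass R (d n) v u))%:E)%E.
Proof.
pose f n (v : G n) : R := (v \in A n)%:R * nbr_frac R d B v.
have f01 n (v : G n) : 0 <= f n v <= 1.
  have /andP[f0 f1] := nbr_frac_itv R admG B v.
  by rewrite /f; case: (v \in A n); rewrite ?mul1r ?f0// mul0r lexx ler01.
rewrite integral_mkcond (eq_integral (fun x => (ufun f x)%:E)); last first.
  move=> x _; rewrite patchE; case: ifPn => xA.
    rewrite lim_deg_internal; congr (_%:E); apply: ulim_near.
    by move/set_mem: xA; apply: filterS => n xA; rewrite /f xA mul1r.
  rewrite -[RHS]/((ulim _)%:E) -[LHS]/(0%:E) -(ulim_cst 0); congr (_%:E).
  apply: ulim_near.
  have /near_omegaN : ~ internal v0 A x by move=> /mem_set; exact/negP.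
  by apply: filterS => n /negP/negbTE xnA; rewrite /f xnA mul0r.
rewrite loeb_integral//; congr (_%:E); apply: ulim_near; apply: nearW => n.
rewrite [RHS]big_mkcond /=; apply: eq_bigr => v _; rewrite /f.
by case: (v \in A n); rewrite ?mul1r ?mul0r ?mulr0// mulr_sumr.
Qed.

Lemma lim_reversible : reversible (lim_prob R admG v0) (lim_deg R admG).
Proof.
apply: (@reversible_on_generators _ X _ _ _ (@measurable _ (uprod v0))) => //.
- by move=> A B; exact: measurableI.
- move=> _ _ [A ->] [B ->]; rewrite !integral_lim_deg_internal.
  congr (_%:E); apply: ulim_near; apply: nearW => n.
  rewrite exchange_big /=; apply: eq_bigr => u _; apply: eq_bigr => v _.
  by rewrite nbr_massC.
Qed.
End limit_reversible.

(** * Homomorphisms of a tree as iterated sums *)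

Lemma sum_tuple_cons (R : nmodType) (T : finType) n (f : seq T -> R) :
  \sum_(t : n.+1.-tuple T) f t = \sum_y \sum_(t : n.-tuple T) f (y :: t).
Proof.
rewrite pair_big /=.
rewrite (reindex (fun p : T * n.-tuple T => [tuple of p.1 :: p.2])) /=.
  by apply: eq_bigr => -[].
exists (fun t => (thead t, [tuple of behead t])) => [[y t] _|t _] /=.
  by rewrite theadE; congr (_, _); exact: val_inj.
by rewrite [RHS]tuple_eta; apply: val_inj.
Qed.

Section extensions.
Variable G : sgraph.

(** The partial map listed by [xs] can be prolonged by the successive values
    [ys] along edges, the [i]-th new node being attached to the earlier node
    number [nth 0 js i]. *)
Fixpoint extends (js : seq nat) (x0 : G) (xs ys : seq G) : bool :=
  match js, ys with
  | j :: js', y :: ys' =>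
      edge (nth x0 xs j) y && extends js' x0 (rcons xs y) ys'
  | _, _ => true
  end.

Lemma iter_sumE (R : realType) d js n x0 xs : size js = n ->
  iter_sum R d js x0 xs =
  (\sum_(t : n.-tuple G) (extends js x0 xs t)%:R) / d%:R ^+ n.
Proof.
elim: js n xs => [|j js IH] [|n] xs //= => [_|[jsn]].
  rewrite expr0 divr1 (eq_bigr (fun=> 1)) => [|t _]; last by case: (tval t).
  by rewrite sumr_const card_tuple expn0.
rewrite (@sum_tuple_cons _ _ _ (fun t => (extends (j :: js) x0 xs t)%:R)).
rewrite mulr_suml; apply: eq_bigr => y _; rewrite (IH n)// /nbr_mass /=.
case: (edge _ _) => /=; last by rewrite !mul0r big1// mul0r.
by rewrite exprS invfM mul1r mulrCA mulrA.
Qed.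

(** The bound on [js] says that each node is attached to an earlier one; this is
    why the growing list can be replaced by the full list [xs ++ ys]. *)
Lemma extendsE js x0 xs ys : size ys = size js ->
  (forall i, (i < size js)%N -> (nth 0 js i < size xs + i)%N) ->
  extends js x0 xs ys =
  all (fun i => edge (nth x0 (xs ++ ys) (nth 0 js i))
                     (nth x0 (xs ++ ys) (size xs + i))) (iota 0 (size js)).
Proof.
elim: js xs ys => [|j js IH] xs [|y ys] //= [sz] jlt.
have j0 : (j < size xs)%N by have := jlt 0%N isT; rewrite addn0.
rewrite addn0 !nth_cat j0 ltnn subnn /=; congr (_ && _).
rewrite IH// => [|i ijs]; last first.
  by have := jlt i.+1 ijs; rewrite size_rcons addSnnS.
rewrite -[1%N]addn0 iotaDl all_map; apply: eq_all => i /=.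
by rewrite size_rcons cat_rcons addSnnS.
Qed.

End extensions.

Section tree_hom.
Variables (F : sgraph) (o : F) (s : #|F|.-tuple F).
Hypothesis labs : is_labeling o s.

Let us : uniq s. Proof. by case/and4P: labs. Qed.

Let s0 : nth o s 0 = o. Proof. by case/and4P: labs => _ _ /eqP. Qed.

Let szs : size s = #|F|. Proof. exact: size_tuple. Qed.

Let F0 : (0 < #|F|)%N. Proof. by apply/card_gt0P; exists o. Qed.

Let mems v : v \in s.
Proof.
have sub : {subset s <= enum F} by move=> x _; rewrite mem_enum.
have [|_ ->] := uniq_min_size us sub; first by rewrite -cardE szs.
by rewrite mem_enum.
Qed.

Let labs1 i : (i.+1 < size s)%N ->
  count (edge (nth o s i.+1)) (take i.+1 s) = 1%N.
Proof.
move=> ilt; case/and4P: labs => _ _ _ /allP/(_ i.+1) h; apply/eqP/h.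
by rewrite mem_iota add1n prednK// szs.
Qed.

Let size_parents : size (parents o s) = #|F|.-1.
Proof. by rewrite size_map size_iota szs. Qed.

Let nth_parents i : (i < #|F|.-1)%N ->
  nth 0%N (parents o s) i = find (edge (nth o s i.+1)) s.
Proof.
by move=> ilt; rewrite (nth_map 0%N) ?size_iota ?szs// nth_iota ?szs// add1n.
Qed.

(** A node of a labeled tree has one earlier neighbor only, so any edge to an
    earlier node leads to the parent that [parents] records. *)
Lemma parent_unique a i : (a <= i)%N -> (i.+1 < size s)%N ->
  edge (nth o s i.+1) (nth o s a) -> find (edge (nth o s i.+1)) s = a.
Proof.
move=> ai ilt; set p := edge _ => pa.
have := labs1 ilt; rewrite -/p -(cat_take_drop a (take i.+1 s)) count_cat.
have asz : (a < size (take i.+1 s))%N by rewrite (size_takel (ltnW ilt)) ltnS.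
rewrite (drop_nth o asz) nth_take ?ltnS//= pa add1n addnS => -[/eqP].
rewrite addn_eq0 => /andP[+ _]; rewrite (take_takel _ (leqW ai)) => c0.
have as' : (a < size s)%N by apply: leq_ltn_trans ai (ltnW ilt).
rewrite -{1}(cat_take_drop a s) find_cat has_count (eqP c0) /=.
by rewrite (drop_nth o as') /= pa addn0 (size_takel (ltnW as')).
Qed.

Lemma parent_edge i : (i.+1 < size s)%N ->
  (find (edge (nth o s i.+1)) s <= i)%N /\
  edge (nth o s i.+1) (nth o s (find (edge (nth o s i.+1)) s)).
Proof.
move=> ilt; set p := edge (nth o s i.+1).
have hp : has p (take i.+1 s) by rewrite has_count (labs1 ilt).
have hps : has p s by rewrite -(cat_take_drop i.+1 s) has_cat hp.
split; last exact: nth_find.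
rewrite -{1}(cat_take_drop i.+1 s) find_cat hp -ltnS.
by rewrite (leq_trans _ (geq_minl i.+1 (size s)))// -size_take_min -has_find.
Qed.

(** Every edge of the tree joins a node to its parent, so [f] preserves all
    edges as soon as it preserves those. *)
Lemma hom_extends (G : sgraph) (f : {ffun F -> G}) :
  [forall u, forall v, edge u v ==> edge (f u) (f v)] =
  extends (parents o s) (f o) [:: f o] (map f (behead s)).
Proof.
have sE : [:: f o] ++ map f (behead s) = map f s.
  case: (tval s) s0 szs => [|a l] /= a0 sz; last by rewrite -a0.
  by move: F0; rewrite -sz.
rewrite extendsE; last 2 first.
- by rewrite size_map size_behead szs size_parents.
- move=> i; rewrite size_parents => ilt; rewrite nth_parents// add1n ltnS.
  by have [] := @parent_edge i; rewrite ?szs -?ltn_predRL.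
rewrite sE size_parents.
have nthE i : (i < #|F|)%N -> nth (f o) (map f s) i = f (nth o s i).
  by move=> ilt; rewrite (nth_map o) ?szs.
have predlt i : (i < #|F|.-1)%N -> (i.+1 < #|F|)%N by rewrite ltn_predRL.
apply/idP/allP => [/forallP fh i|fh].
  rewrite mem_iota add0n /= => ilt.
  have ilt' : (i.+1 < size s)%N by rewrite szs predlt.
  have [le ed] := parent_edge ilt'.
  rewrite nth_parents// add1n !nthE ?predlt//; last first.
    by apply: leq_ltn_trans le _; apply: ltnW; exact: predlt.
  set j := find _ _ in ed *; rewrite edge_sym.
  by have /forallP/(_ (nth o s j))/implyP := fh (nth o s i.+1); apply.
have main a b : (a < b)%N -> (b < #|F|)%N -> edge (nth o s b) (nth o s a) ->
    edge (f (nth o s b)) (f (nth o s a)).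
  case: b => // b ab bF ed.
  have bF' : (b < #|F|.-1)%N by rewrite ltn_predRL.
  have := fh b; rewrite mem_iota add0n bF' => /(_ isT).
  rewrite nth_parents// (parent_unique _ _ ed)//; last by rewrite szs.
  by rewrite add1n !nthE//; [rewrite edge_sym|exact: ltn_trans ab bF].
apply/forallP => u; apply/forallP => v; apply/implyP => uv.
have iu : (index u s < #|F|)%N by have := mems u; rewrite -index_mem szs.
have iv : (index v s < #|F|)%N by have := mems v; rewrite -index_mem szs.
rewrite -(nth_index o (mems u)) -(nth_index o (mems v)) in uv *.
case: (ltngtP (index u s) (index v s)) => [lt|lt|eq].
- by rewrite edge_sym; apply: main => //; rewrite edge_sym.
- exact: main.
- by rewrite eq edge_irrefl in uv.
Qed.

(** A map from [F] to [G] is the same as the value at the root together with the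
    tuple of the other values, in the order of the labeling. *)
Lemma hom_densityE (R : realType) (G : sgraph) d :
  hom_density R F G d =
  #|G|%:R^-1 * \sum_(v : G) iter_sum R d (parents o s) v [:: v].
Proof.
rewrite /hom_density invfM mulrCA; congr (_ * _).
under eq_bigr do rewrite (iter_sumE _ _ _ _ size_parents).
rewrite -mulr_suml; congr (_ / _).
rewrite pair_big /=.
have -> : (Defs.hom F G)%:R = \sum_(f : {ffun F -> G})
    [forall u, forall v, edge u v ==> edge (f u) (f v)]%:R :> R.
  rewrite /Defs.hom -sum1_card natr_sum big_mkcond; apply: eq_bigr => f _.
  by rewrite inE; case: ifP.
pose h (f : {ffun F -> G}) : G * #|F|.-1.-tuple G :=
  (f o, map_tuple f (behead_tuple s)).
pose g (p : G * #|F|.-1.-tuple G) : {ffun F -> G} :=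
  [ffun x => nth p.1 (p.1 :: p.2) (index x s)].
have sE : o :: behead s = s :> seq F.
  case: (tval s) s0 szs => [|a l] /= a0 sz; last by rewrite -a0.
  by move: F0; rewrite -sz.
rewrite [RHS](reindex h); last first.
  exists g => [f _|[v t] _].
    apply/ffunP => x; rewrite ffunE /= -map_cons sE (nth_map o) ?index_mem//.
    by rewrite nth_index.
  rewrite /h /g; congr (_, _).
    by rewrite ffunE -sE /= eqxx.
  apply: val_inj; apply: (@eq_from_nth _ v) => /=.
    by rewrite size_map size_behead szs size_tuple.
  move=> i; rewrite size_map => ib; rewrite (nth_map o)//.
  rewrite ffunE nth_behead index_uniq//=.
  by move: ib; rewrite size_behead ltn_predRL.
by apply: eq_bigr => f _; rewrite hom_extends.
Qed.

End tree_hom.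

(** * Products with a hypercube *)

Section hypercube.
Variable m : nat.
Local Notation cube := {ffun 'I_m -> bool}.
Implicit Types p q : cube.

Definition hamming p q : nat := #|[set i | p i != q i]%SET|.

Definition flip q (i : 'I_m) : cube := [ffun j => q j (+) (j == i)].

Lemma hammingC p q : hamming p q = hamming q p.
Proof. by apply: eq_card => i; rewrite !inE eq_sym. Qed.

Lemma hamming0 p : hamming p p = 0%N.
Proof. by apply: eq_card0 => i; rewrite !inE eqxx. Qed.

Lemma hamming_flip p q i : p i = q i -> hamming p (flip q i) = (hamming p q).+1.
Proof.
move=> pq; rewrite /hamming.
rewrite (_ : [set j | p j != flip q i j]%SET = i |: [set j | p j != q j]%SET).
  by rewrite cardsU1 inE pq eqxx.
apply/setP => j; rewrite !inE ffunE; have [->|_] := eqVneq j i; last first.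
  by case: (p j); case: (q j).
by rewrite pq; case: (q i).
Qed.

Lemma flip_inj q : injective (flip q).
Proof.
move=> i j /ffunP/(_ i); rewrite !ffunE eqxx.
by case: (eqVneq i j) => // _; case: (q i).
Qed.

Lemma hamming1E p q :
  (hamming p q == 1%N) = (q \in [set flip p i | i : 'I_m]%SET).
Proof.
apply/idP/imsetP => [/cards1P[i /setP pqi]|[i _ ->]]; last first.
  by rewrite hamming_flip// hamming0.
exists i => //; apply/ffunP => j; rewrite ffunE; have := pqi j; rewrite !inE.
by case: (j == i); case: (p j); case: (q j).
Qed.

Lemma sum_hamming1 (R : nmodType) p (f : cube -> R) :
  \sum_(q | hamming p q == 1%N) f q = \sum_i f (flip p i).
Proof.
under eq_bigl do rewrite hamming1E.
by rewrite big_imset //= => i j _ _; exact: flip_inj.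
Qed.

End hypercube.

Section cube_product.
Variables (G : sgraph) (m : nat).
Local Notation cube := {ffun 'I_m -> bool}.

Definition cube_edge : rel (G * cube) :=
  fun x y => edge x.1 y.1 && (hamming x.2 y.2 == 1%N).

Lemma cube_edge_sym : symmetric cube_edge.
Proof. by move=> x y; rewrite /cube_edge edge_sym hammingC. Qed.

Lemma cube_edge_irrefl : irreflexive cube_edge.
Proof. by move=> x; rewrite /cube_edge edge_irrefl. Qed.

Definition cube_product : sgraph := SGraph cube_edge_sym cube_edge_irrefl.

Lemma sum_cube_nbr (R : pzSemiRingType) (v : G) (q : cube)
    (f : cube_product -> R) :
  \sum_(y : cube_product) (edge ((v, q) : cube_product) y)%:R * f y =
  \sum_w \sum_i (edge v w)%:R * f (w, flip q i).
Proof.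
rewrite (eq_bigr (fun y => (edge v y.1)%:R *
  ((hamming q y.2 == 1%N)%:R * f (y.1, y.2)))).
  rewrite -(pair_bigA _ (fun w q' => (edge v w)%:R *
    ((hamming q q' == 1%N)%:R * f (w, q')))) /=.
  apply: eq_bigr => w _; rewrite -!mulr_sumr.
  rewrite -(sum_hamming1 q (fun q' => f (w, q'))); congr (_ * _).
  rewrite [RHS]big_mkcond /=; apply: eq_bigr => q' _.
  by case: eqP; rewrite ?mul1r ?mul0r.
move=> [w q'] _; rewrite mulrA -natrM mulnb; congr (_%:R * _).
Qed.

Lemma cube_product_degree (y : cube_product) : degree y = (degree y.1 * m)%N.
Proof.
rewrite /degree -[X in (_ * X)%N]card_ord.
rewrite -(card_imset _ (@flip_inj m y.2)) -cardsX; apply: eq_card => z.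
by rewrite !inE -hamming1E.
Qed.

Lemma cube_product_admissible d : (0 < m)%N -> admissible G d ->
  admissible cube_product (d * m).
Proof.
move=> m0 [G0 d0 degG]; split.
- by rewrite card_prod muln_gt0 G0 card_ffun card_bool expn_gt0.
- by rewrite muln_gt0 d0.
- by move=> y; rewrite cube_product_degree leq_mul2r degG orbT.
Qed.

Variables (R : realType) (d : nat).
Hypotheses (m0 : (0 < m)%N).

(** A step in the product is a step in [G] and an independent uniform flip. *)
Lemma sum_cube_nbr_mass (v : G) (q : cube) (f : cube_product -> R) :
  \sum_y nbr_mass R (d * m) ((v, q) : cube_product) y * f y =
  \sum_w nbr_mass R d v w * (m%:R^-1 * \sum_i f (w, flip q i)).
Proof.
rewrite (eq_bigr (fun y => (d * m)%:R^-1 *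
  ((edge ((v, q) : cube_product) y)%:R * f y))); last first.
  by move=> y _; rewrite mulrA [_^-1 * _]mulrC.
rewrite -mulr_sumr sum_cube_nbr mulr_sumr; apply: eq_bigr => w _.
by rewrite -mulr_sumr natrM invfM mulrACA [d%:R^-1 * _]mulrC.
Qed.

(** By induction the summand depends on the first coordinates only, so averaging
    it over the [m] flips has no effect. *)
Lemma iter_sum_cube js (x0 : cube_product) (xs : seq cube_product) :
  iter_sum R (d * m) js x0 xs = iter_sum R d js x0.1 [seq x.1 | x <- xs].
Proof.
elim: js xs => [//|j js IH] xs /=.
have -> : nth x0.1 [seq x.1 | x <- xs] j = (nth x0 xs j).1.
  have [jxs|jxs] := ltnP j (size xs); first by rewrite (nth_map x0).
  by rewrite !nth_default// size_map.
case: (nth x0 xs j) => v q /=; rewrite sum_cube_nbr_mass.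
apply: eq_bigr => w _; congr (_ * _).
rewrite (eq_bigr (fun=> iter_sum R d js x0.1 (rcons [seq x.1 | x <- xs] w))).
  rewrite sumr_const card_ord mulrnAr -mulrnAl -[m%:R^-1 *+ m]mulr_natr.
  by rewrite mulVf ?mul1r// pnatr_eq0 -lt0n.
by move=> i _; rewrite IH map_rcons.
Qed.

Lemma hom_density_cube F : is_tree F ->
  hom_density R F cube_product (d * m) = hom_density R F G d.
Proof.
move=> treeF; have /card_gt0P[r _] := treeF.1.1.
have [s labs] := labeling_exists treeF r.
rewrite !(hom_densityE labs) card_prod natrM invfM -mulrA; congr (_ * _).
rewrite (eq_bigr (fun y => iter_sum R d (parents r s) y.1 [:: y.1])); last first.
  by move=> y _; rewrite iter_sum_cube.
rewrite -(pair_bigA _ (fun v q => iter_sum R d (parents r s) v [:: v])) /=.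
rewrite mulr_sumr; apply: eq_bigr => v _.
rewrite sumr_const mulrnAr -mulrnAl -[X in X * _]mulr_natr mulVf ?mul1r//.
by rewrite pnatr_eq0 -lt0n card_ffun card_bool expn_gt0.
Qed.

(** A flip that does not increase the distance to [p] flips one of the
    coordinates where [p] and [y.2] differ. *)
Lemma cube_backward (admG : admissible G d) (p : cube) (y : cube_product) :
  \sum_(z : cube_product | hamming p z.2 != (hamming p y.2).+1)
     nbr_mass R (d * m) y z <= (hamming p y.2)%:R / m%:R.
Proof.
case: y => v q /=; rewrite big_mkcond /=.
rewrite (eq_bigr (fun z => nbr_mass R (d * m) ((v, q) : cube_product) z *
   (hamming p z.2 != (hamming p q).+1)%:R)); last first.
  by move=> z _; case: ifP => _; rewrite ?mulr1 ?mulr0.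
rewrite sum_cube_nbr_mass /= -mulr_suml [leRHS]mulrC.
rewrite -[leRHS]mul1r; apply: ler_pM; rewrite ?nbr_mass_le1//.
- by apply: sumr_ge0 => w _; exact: nbr_mass_ge0.
- by rewrite mulr_ge0// sumr_ge0.
apply: ler_wpM2l => //; rewrite -natr_sum ler_nat [leqRHS]/hamming.
rewrite -[leqRHS]sum1dep_card [leqRHS]big_mkcond; apply: leq_sum => i _.
by have [/hamming_flip->|_] := eqVneq (p i) (q i); rewrite ?eqxx// leq_b1.
Qed.

End cube_product.

(** * The limit of the products, acyclicity *)

Section cube_limit.
Variables (R : realType) (G : nat -> sgraph) (d : nat -> nat).
Hypothesis admG : forall n, admissible (G n) (d n).

Let H n := cube_product (G n) n.+1.
Let dH n := (d n * n.+1)%N.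

Lemma cube_admissible n : admissible (H n) (dH n).
Proof. exact: cube_product_admissible. Qed.
Local Notation admH := cube_admissible.

Variable v0 : forall n, H n.
Local Notation X := (loeb_space (V := fun n => vertex (H n)) v0).
Local Notation deg := (lim_deg R admH (v0 := v0)).

Definition sphere_nth (x : X) (j : nat) n : {set H n} :=
  [set y : H n | hamming (x n).2 y.2 == j]%SET.

Definition sphere (x : X) (j : nat) : set X := internal v0 (sphere_nth x j).

Lemma measurable_sphere x j : measurable (sphere x j).
Proof. exact: measurable_internal. Qed.

Lemma sphere0 x : sphere x 0 x.
Proof. by apply: nearW => n; rewrite inE hamming0. Qed.

Lemma sphere_disjoint x i j : i != j -> sphere x i `<=` ~` sphere x j.
Proof.
move=> ij y yi yj; have /filter_ex[n] : \forall n \near omega, False; last by [].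
apply: filterS2 yi yj => n; rewrite !inE => /eqP -> /eqP eij.
by rewrite eij eqxx in ij.
Qed.

(** By [cube_backward] the exceptional steps have mass at most [j / (n + 1)] in
    the [n]-th graph. *)
Lemma deg_sphere x y j : sphere x j y -> deg y (~` sphere x j.+1) = 0%E.
Proof.
move=> yj; rewrite /sphere internalC lim_deg_internal; congr (_%:E).
apply: ulim_eq.
apply: (@squeeze_cvgr _ _ _ _ (fun=> 0) (fun n => j%:R * n.+1%:R^-1)).
- apply: filterS yj => n; rewrite inE => /eqP yj; apply/andP; split.
    by apply: sumr_ge0 => z _; exact: nbr_mass_ge0.
  have := cube_backward R (admG n) (x n).2 (y n); rewrite yj.
  by congr (_ <= _); apply: eq_bigl => z; rewrite !inE.
- exact: cvg_cst.
- apply: cvgn_ulim; rewrite -[X in _ --> X](mulr0 j%:R).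
  by apply: cvgMl_tmp; exact: cvg_harmonic.
Qed.

(** The powers of the kernel are defined by splitting off the first step, after
    which the walk starts at distance [j + 1] from [x]. The induction therefore
    has to allow a start [y] different from the center [x]. *)
Lemma kpow_sphere k x y j : sphere x j y ->
  kpow deg k y (~` sphere x (j + k)) = 0%E.
Proof.
elim: k y j => [|k IH] y j yj.
  by rewrite kpow0E diracE addn0 memNset//; apply.
have [->|k0] := posnP k; first by rewrite kpow1E addn1; exact: deg_sphere.
have mC i : measurable (~` sphere x i).
  by apply: measurableC; exact: measurable_sphere.
rewrite kpowSE//; apply/eqP; rewrite eq_le integral_ge0 ?andbT//.
apply: (@le_trans _ _
    (\int[deg y]_z (\1_(~` sphere x j.+1) z : R)%:E)%E); last first.
  by rewrite integral_indic// setIT (deg_sphere yj).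
apply: ge0_le_integral => //.
- exact/measurable_kernel.
- by apply/measurable_EFinP; exact: measurable_indic.
- move=> z _; rewrite indicE; case: (boolP (z \in ~` sphere x j.+1)) => zj.
    apply: le_trans (sprob_kernel_le1 (kpow deg k) z).
    by apply: le_measure; rewrite ?inE.
  by rewrite addnS -addSn IH//; move/negP: zj; rewrite inE => /contrapT.
Qed.

Lemma cube_limit_acyclic : acyclic_kernel (lim_prob R admH v0) deg.
Proof.
apply: aeW => x n n1; exists (sphere x 1); split.
- exact: measurable_sphere.
- have := kpow_sphere n (sphere0 x); rewrite add0n => kn.
  apply/eqP; rewrite eq_le measure_ge0 andbT -kn.
  apply: le_measure; rewrite ?inE; [exact: measurable_sphere| |].
    by apply: measurableC; exact: measurable_sphere.
  by apply: sphere_disjoint; rewrite eq_sym; exact/eqP.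
- by have := deg_sphere (sphere0 x).
Qed.

Lemma tree_density_cube_limit (F : sgraph) l : is_tree F ->
  hom_density R F (G n) (d n) @[n --> \oo] --> l ->
  tree_density F (lim_prob R admH v0) deg = l%:E.
Proof.
move=> treeF Fl; rewrite /tree_density; case: pickP => [r _|F0]; last first.
  by have /card_gt0P[r _] := treeF.1.1; have := F0 r.
rewrite /rooted_density; case: pickP => [s labs|nolab]; last first.
  by have [s] := labeling_exists treeF r; rewrite nolab.
rewrite integral_iter_int; congr (_%:E); apply: ulim_eq; apply: cvgn_ulim.
rewrite (_ : (fun _ => _) = fun n => hom_density R F (G n) (d n))//.
by apply/funext => n; rewrite -hom_densityE// hom_density_cube.
Qed.

End cube_limit.

Theorem theorem5p12 (R : realType) (G : nat -> sgraph) (d : nat -> nat)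
    (admGd : forall n, admissible (G n) (d n))
    (cvgGd : forall F : sgraph, is_tree F ->
       cvgn (fun n => hom_density R F (G n) (d n))) :
  exists (disp : measure_display) (X : measurableType disp)
         (lambda : probability X R) (deg : R.-spker X ~> X),
    [/\ reversible lambda deg,
        acyclic_kernel lambda deg &
        forall F : sgraph, is_tree F ->
          (hom_density R F (G n) (d n))%:E @[n --> \oo]
            --> tree_density F lambda deg].
Proof.
have v0 n : cube_product (G n) n.+1.
  have [+ _ _] := cube_product_admissible (ltn0Sn n) (admGd n).
  by move=> /card_gt0P/cid[].
exists _, _, (lim_prob R (cube_admissible admGd) v0).
exists (lim_deg R (cube_admissible admGd)); split.
- exact: lim_reversible.
- exact: cube_limit_acyclic.
- move=> F treeF.
  rewrite (tree_density_cube_limit admGd v0 treeF (cvgGd F treeF)).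
  by apply: cvg_EFin; [exact: nearW|exact: cvgGd].
Qed.
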